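(* There exists a numerical constant $C\ge1$ such that the following holds. Let $p\ge3$, let $d_1,\dots,d_p\ge 1$ be integers, $d_{\min}=\min\{d_1,\ldots,d_p\}$, let $$\mathscr{T}=\sum_{k=1}^{d_{\min}}\lambda_k\,\mathbf{u}_k^{(1)}\otimes\cdots\otimes\mathbf{u}_k^{(p)}\in\mathbb{R}^{d_1\times\cdots\times d_p}$$ be an odeco tensor, let $\mathscr{E}\in\mathbb{R}^{d_1\times\cdots\times d_p}$ be an arbitrary tensor, let $\mathscr{X}:=\mathscr{T}+\mathscr{E}$, and let $$\tilde{\mathscr{T}}=\sum_{k=1}^{d_{\min}}\tilde\lambda_k\,\tilde{\mathbf{u}}_k^{(1)}\otimes\cdots\otimes\tilde{\mathbf{u}}_k^{(p)}\in\mathbb{R}^{d_1\times\cdots\times d_p}$$ be any odeco tensor (regarded as an odeco approximation to $\mathscr{X}$). Here $\lambda_1\ge\cdots\ge\lambda_{d_{\min}}\ge0$, $\tilde\lambda_1\ge\cdots\ge\tilde\lambda_{d_{\min}}\ge0$, and for each $q$ the vectors $\mathbf{u}_1^{(q)},\ldots,\mathbf{u}_{d_{\min}}^{(q)}\in\mathbb{R}^{d_q}$ are orthonormal, and likewise $\tilde{\mathbf{u}}_1^{(q)},\ldots,\tilde{\mathbf{u}}_{d_{\min}}^{(q)}\in\mathbb{R}^{d_q}$ are orthonormal. Then there is a permutation $\pi$ of $\{1,\ldots,d_{\min}\}$ such that for all $k=1,\ldots,d_{\min}$, $$|\lambda_k-\tilde\lambda_{\pi(k)}|\le C\big(\|\tilde{\mathscr{T}}-\mathscr{X}\|+\|\mathscr{E}\|\big)$$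 and $$\max_{1\le q\le p}\sin\angle(\mathbf{u}_k^{(q)},\tilde{\mathbf{u}}_{\pi(k)}^{(q)})\le\frac{C\big(\|\tilde{\mathscr{T}}-\mathscr{X}\|+\|\mathscr{E}\|\big)}{\lambda_k}.$$
   Context: A tensor in $\mathbb{R}^{d_1\times\cdots\times d_p}$ is odeco (orthogonally decomposable) if it admits a decomposition of the form displayed in the claim. For vectors $\mathbf{u},\mathbf{v}$, $\angle(\mathbf{u},\mathbf{v})\in[0,\pi/2]$ denotes the angle between the lines they span, so for unit vectors $\sin\angle(\mathbf{u},\mathbf{v})=\sqrt{1-\langle\mathbf{u},\mathbf{v}\rangle^2}$. The spectral norm of a tensor $\mathscr{A}\in\mathbb{R}^{d_1\times\cdots\times d_p}$ is $\|\mathscr{A}\|=\max\langle\mathscr{A},\mathbf{x}^{(1)}\otimes\cdots\otimes\mathbf{x}^{(p)}\rangle$, the maximum being over unit vectors $\mathbf{x}^{(q)}\in\mathbb{R}^{d_q}$, where $\langle\cdot,\cdot\rangle$ is the entrywise inner product. Convention: $1/0=+\infty$, so when $\lambda_k=0$ the second inequality imposes nothing. *)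

(* Defs.v *)
From mathcomp Require Import all_boot all_order all_algebra perm.
From mathcomp Require Import all_classical all_reals all_analysis.

Set Implicit Arguments.
Unset Strict Implicit.
Unset Printing Implicit Defensive.

Import Order.TTheory GRing.Theory Num.Theory.

Local Open Scope classical_set_scope.
Local Open Scope ring_scope.

(* [minn] has no neutral element on [nat]; the default value \max_q d q is
   neutral for the values at hand, so for p > 0 this is the true minimum. *)
Definition dmin (p : nat) (d : 'I_p -> nat) : nat :=
  (\big[minn/(\max_(q < p) d q)]_(q < p) d q)%N.

(* A tensor is its array of entries, indexed by the multi-indices
   (i_1, ..., i_p) with i_q < d q. The entries are in R^o, which is R seen as
   a module over itself, so that tensors inherit the lmodType structure. *)
Definition tensor (R : realType) (p : nat) (d : 'I_p -> nat) : Type :=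
  {ffun {dffun forall q : 'I_p, 'I_(d q)} -> R^o}.

Definition dotv (R : realType) (n : nat) (u v : 'rV[R]_n) : R :=
  \sum_(i < n) u 0 i * v 0 i.

(* Not the library norm `|v| on matrices, which is the sup norm. *)
Definition norm2 (R : realType) (n : nat) (v : 'rV[R]_n) : R :=
  Num.sqrt (dotv v v).

Definition orthonormal_family (R : realType) (m n : nat)
    (u : 'I_m -> 'rV[R]_n) : Prop :=
  forall k l : 'I_m, dotv (u k) (u l) = (k == l)%:R.

(* The absolute value makes this the angle in [0, pi/2] between lines. *)
Definition angle (R : realType) (n : nat) (u v : 'rV[R]_n) : R :=
  acos (`|dotv u v| / (norm2 u * norm2 v)).

Definition outer (R : realType) (p : nat) (d : 'I_p -> nat)
    (x : forall q : 'I_p, 'rV[R]_(d q)) : tensor R d :=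
  [ffun i : {dffun forall q : 'I_p, 'I_(d q)} => \prod_(q < p) x q 0 (i q)].

Definition dott (R : realType) (p : nat) (d : 'I_p -> nat)
    (A B : tensor R d) : R :=
  \sum_i A i * B i.

(* When every d q is positive the set below is nonempty and compact, so that
   the supremum is a maximum. *)
Definition spectral_norm (R : realType) (p : nat) (d : 'I_p -> nat)
    (A : tensor R d) : R :=
  sup [set dott A (outer x) |
         x in [set x : forall q : 'I_p, 'rV[R]_(d q) |
                 forall q : 'I_p, norm2 (x q) = 1]].

Definition odeco_decomposition (R : realType) (p : nat) (d : 'I_p -> nat)
    (lambda : 'I_(dmin d) -> R)
    (u : 'I_(dmin d) -> forall q : 'I_p, 'rV[R]_(d q))
    (T : tensor R d) : Prop :=
  [/\ forall k l : 'I_(dmin d), (k <= l)%N -> lambda l <= lambda k,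
      forall k : 'I_(dmin d), 0 <= lambda k,
      forall q : 'I_p, orthonormal_family (fun k => u k q) &
      T = \sum_(k < dmin d) lambda k *: outer (u k)].

(* Main.v *)
Require Import Defs.
From mathcomp Require Import all_boot all_order all_algebra perm.
From mathcomp Require Import all_classical all_reals all_analysis.
From mathcomp Require Import ring lra.

(* Let eps bound the spectral norm of T' - T, and let a_q = <u_k^q, u'_l^q>.
   Testing T' - T on u_k with its mode-m vector replaced by u'_l^m gives
   lambda_k |a_m| <= eps + lambda'_l prod_(q <> m) |a_q|, and likewise with the
   roles of T and T' exchanged. Since p >= 3, these force each pair (k, l) to be
   either close, meaning |a_q| > 3/4 for all q, or far, meaning
   (lambda_k + lambda'_l) |a_q| <= 8 eps for all q. As 2 (3/4)^2 > 1, Bessel's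
   inequality makes closeness a partial matching, which extends to a
   permutation. Testing T' - T on u_k with its mode-m vector replaced by a unit
   y orthogonal to the u'_l^m with l close to k leaves only far terms, so
   lambda_k <u_k^m, y> <= 9 eps. For matched k, the normalized component of
   u_k^m orthogonal to its partner gives the sine bound; for unmatched k, y = u_k^m
   gives lambda_k <= 9 eps, so that both bounds are trivial. Thus C = 9. *)

Set Implicit Arguments.
Unset Strict Implicit.
Unset Printing Implicit Defensive.

Import Order.TTheory GRing.Theory Num.Theory.

Local Open Scope ring_scope.

(** * Distributivity and partial matchings *)

(** This lets the inner product of two rank-one tensors factor into a product over modes. *)
Lemma sum_dffun_prod (S : comPzSemiRingType) (I : finType) (J : I -> finType)
    (F : forall i, J i -> S) :
  \sum_(f : {dffun forall i, J i}) \prod_i F i (f i) = \prod_i \sum_j F i j.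
Proof.
rewrite (reindex (@dffun_of_fprod I J)); last exact/onW_bij/dffun_of_fprod_bij.
transitivity (\sum_(t : fprod J) \prod_(i in I) [ffun j => F i j] (t i)).
  by apply: eq_bigr => t _; apply: eq_bigr => i _; rewrite !ffunE.
rewrite big_fprod; under [RHS]eq_bigr => i _.
  rewrite (eq_bigr [ffun j => F i j]) => [|j _]; last by rewrite ffunE.
  rewrite (big_tag (fun i => [ffun j => F i j])); over.
by rewrite bigA_distr_big_dep.
Qed.

(* A permutation maximizing the number of respected pairs respects all of them:
   otherwise a transposition would improve it. *)
Lemma perm_of_matching (T : finType) (r : rel T) :
  (forall x y z, r x y -> r x z -> y = z) ->
  (forall x y z, r x z -> r y z -> x = y) ->
  exists s : {perm T}, forall x y, r x y -> s x = y.
Proof.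
move=> rfun rinj.
pose good (s : {perm T}) := [set x | r x (s x)]%SET.
have [s _ smax] := arg_maxnP (fun s => #|good s|) (erefl : predT (1 : {perm T})%g).
exists s => x y rxy; apply/eqP/negPn/negP => sxy.
pose s' := (s * tperm (s x) y)%g.
suff /proper_card : good s \proper good s'
  by rewrite ltnNge (smax s' isT : #|good s'| <= #|good s|)%N.
apply/properP; split; last first.
  exists x; rewrite !inE; first by rewrite permM tpermL.
  by apply/negP => rxs; rewrite (rfun _ _ _ rxy rxs) eqxx in sxy.
(* The transposition moves no pair already respected: [s z = s x] would give [s x = y] by [rfun],
   and [s z = y] would give [z = x] by [rinj]. *)
apply/fintype.subsetP => z; rewrite !inE => rz.
rewrite permM tpermD //; apply/eqP => e; case/eqP: sxy.
  by move: rz; rewrite -(perm_inj e) => /rfun/(_ rxy).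
by move: rz; rewrite -e => /rinj/(_ rxy) => zx; rewrite e zx.
Qed.

(** * Euclidean vectors, Bessel's inequality and angles *)

Lemma dotvC (R : realType) n (u v : 'rV[R]_n) : dotv u v = dotv v u.
Proof. by apply: eq_bigr => i _; rewrite mulrC. Qed.

Lemma dotvBl (R : realType) n (u v w : 'rV[R]_n) :
  dotv (u - v) w = dotv u w - dotv v w.
Proof. by rewrite -sumrB; apply: eq_bigr => i _; rewrite !mxE mulrBl. Qed.

Lemma dotvBr (R : realType) n (u v w : 'rV[R]_n) :
  dotv w (u - v) = dotv w u - dotv w v.
Proof. by rewrite dotvC dotvBl !(dotvC w). Qed.

Lemma dotvZl (R : realType) n a (u v : 'rV[R]_n) : dotv (a *: u) v = a * dotv u v.
Proof. by rewrite mulr_sumr; apply: eq_bigr => i _; rewrite !mxE mulrA. Qed.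

Lemma dotvZr (R : realType) n a (u v : 'rV[R]_n) : dotv u (a *: v) = a * dotv u v.
Proof. by rewrite dotvC dotvZl dotvC. Qed.

Lemma dotv_suml (R : realType) n (I : finType) (F : I -> 'rV[R]_n) v :
  dotv (\sum_i F i) v = \sum_i dotv (F i) v.
Proof.
rewrite exchange_big; apply: eq_bigr => j _.
by rewrite summxE mulr_suml.
Qed.

Lemma dotvv_ge0 (R : realType) n (u : 'rV[R]_n) : 0 <= dotv u u.
Proof. by apply: sumr_ge0 => i _; rewrite -expr2 sqr_ge0. Qed.

Lemma norm2_eq1 (R : realType) n (u : 'rV[R]_n) : norm2 u = 1 -> dotv u u = 1.
Proof. by move=> u1; rewrite -(sqr_sqrtr (dotvv_ge0 u)) -/(norm2 u) u1 expr1n. Qed.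

Lemma orthonormal_norm2 (R : realType) m n (u : 'I_m -> 'rV[R]_n) k :
  orthonormal_family u -> norm2 (u k) = 1.
Proof. by move=> ou; rewrite /norm2 ou eqxx sqrtr1. Qed.

(** Here [w] is the projection of [y] onto the span of the family, and the residual [y - w] has
    nonnegative squared norm. *)
Lemma bessel (R : realType) m n (u : 'I_m -> 'rV[R]_n) (y : 'rV[R]_n) :
  orthonormal_family u -> \sum_k dotv (u k) y ^+ 2 <= dotv y y.
Proof.
move=> ou; pose w := \sum_k dotv (u k) y *: u k.
have wy : dotv w y = \sum_k dotv (u k) y ^+ 2.
  by rewrite dotv_suml; apply: eq_bigr => k _; rewrite dotvZl.
have ww : dotv w w = \sum_k dotv (u k) y ^+ 2.
  rewrite dotv_suml; apply: eq_bigr => k _; rewrite dotvZl expr2; congr (_ * _).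
  rewrite dotvC dotv_suml (bigD1 k) //= dotvZl ou eqxx mulr1 big1 ?addr0 // => l lk.
  by rewrite dotvZl ou (negPf lk) mulr0.
have := dotvv_ge0 (y - w).
by rewrite dotvBl !dotvBr (dotvC y w) wy ww subrr subr0 subr_ge0.
Qed.

Lemma orthonormal_dotv_le1 (R : realType) m n (u : 'I_m -> 'rV[R]_n) y k :
  orthonormal_family u -> norm2 y = 1 -> `|dotv (u k) y| <= 1.
Proof.
move=> ou y1; rewrite -(@ler_pXn2r _ 2) ?nnegrE // real_normK ?num_real // expr1n.
rewrite -(norm2_eq1 y1); apply: le_trans (bessel y ou).
by rewrite (bigD1 k) //= lerDl sumr_ge0 // => l _; exact: sqr_ge0.
Qed.

Lemma sin_angle (R : realType) n (u v : 'rV[R]_n) :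
  norm2 u = 1 -> norm2 v = 1 -> `|dotv u v| <= 1 ->
  sin (angle u v) = Num.sqrt (1 - dotv u v ^+ 2).
Proof.
move=> u1 v1 uv1; rewrite /angle u1 v1 mulr1 divr1 sin_acos.
  by rewrite real_normK ?num_real.
by rewrite uv1 andbT (le_trans _ (normr_ge0 _)) // lerN10.
Qed.

(** * Pairing with rank-one tensors and the spectral norm *)

Lemma dott_sumZ_outer (R : realType) p (d : 'I_p -> nat) n (lam : 'I_n -> R)
    (u : 'I_n -> forall q, 'rV[R]_(d q)) (x : forall q, 'rV[R]_(d q)) :
  dott (\sum_k lam k *: outer (u k)) (outer x)
  = \sum_k lam k * \prod_q dotv (u k q) (x q).
Proof.
rewrite /dott; under eq_bigr => i _ do rewrite sum_ffunE mulr_suml.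
rewrite exchange_big; apply: eq_bigr => k _.
rewrite /dotv -(sum_dffun_prod (fun q j => u k q 0 j * x q 0 j)) mulr_sumr.
by apply: eq_bigr => i _; rewrite !ffunE big_split -mulrA.
Qed.

Lemma dottDl (R : realType) p (d : 'I_p -> nat) (A B C : tensor R d) :
  dott (A + B) C = dott A C + dott B C.
Proof. by rewrite -big_split; apply: eq_bigr => i _; rewrite !ffunE mulrDl. Qed.

Lemma dott_le_spectral_norm (R : realType) p (d : 'I_p -> nat) (A : tensor R d)
    (x : forall q, 'rV[R]_(d q)) :
  (forall q, norm2 (x q) = 1) -> dott A (outer x) <= spectral_norm A.
Proof.
move=> x1; apply: ub_le_sup; last by exists x.
(* The supremum is over a bounded set: entries of unit vectors have absolute value at most 1. *)
exists (\sum_i `|A i|) => _ [z z1 <-]; apply: ler_sum => i _.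
apply: le_trans (ler_norm _) _; rewrite normrM ler_piMr // ffunE normr_prod.
apply: prodr_ile1 => q _; rewrite normr_ge0 /=.
rewrite -(@ler_pXn2r _ 2) ?nnegrE // real_normK ?num_real // expr1n.
rewrite -(norm2_eq1 (z1 q)) /dotv (bigD1 (i q)) //= -expr2 lerDl.
by apply: sumr_ge0 => j _; rewrite -expr2 sqr_ge0.
Qed.

(** Negating the vector of a single mode negates the pairing, so the one-sided bound is
    two-sided. *)
Lemma normr_dott_le (R : realType) p (d : 'I_p -> nat) (A : tensor R d)
    (x : forall q, 'rV[R]_(d q)) :
  (0 < p)%N -> (forall q, norm2 (x q) = 1) ->
  `|dott A (outer x)| <= spectral_norm A.
Proof.
move=> p0 x1; rewrite ler_norml dott_le_spectral_norm // andbT lerNl.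
pose q0 := Ordinal p0.
have x'1 q : norm2 (dfwith x q0 (- x q0) q) = 1.
  case: dfwithP => // ; rewrite -[RHS](x1 q0) /norm2 -scaleN1r dotvZl dotvZr.
  by rewrite mulrA mulrNN !mul1r.
apply: le_trans (dott_le_spectral_norm A x'1).
rewrite le_eqVlt; apply/orP; left; apply/eqP.
rewrite /dott -sumrN; apply: eq_bigr => i _; rewrite !ffunE -mulrN; congr (_ * _).
rewrite (bigD1 q0) // [in RHS](bigD1 q0) //= dfwithin mxE mulNr; congr (- (_ * _)).
by apply: eq_bigr => q qq0; rewrite dfwithout // eq_sym.
Qed.

(** * Selecting modes *)

(** The case [r = m] serves to find one mode other than [m]. *)
Lemma exists_third p (m r : 'I_p) :
  (3 <= p)%N -> exists2 s, s != m & s != r.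
Proof.
move=> p3; have /set0Pn[s] : ~: [set m; r]%SET != finset.set0.
  rewrite -card_gt0 cardsCs finset.setCK card_ord subn_gt0.
  by apply: leq_ltn_trans p3; rewrite cards2; case: (m != r).
by rewrite !inE negb_or => /andP[]; exists s.
Qed.

Lemma normr_prod_le2 (R : realType) p (f : 'I_p -> R) m r s :
  (forall q, `|f q| <= 1) -> r != m -> s != m -> s != r ->
  `|\prod_(q < p | q != m) f q| <= `|f r| * `|f s|.
Proof.
move=> f1 rm sm sr; rewrite (bigD1 r) //= (bigD1 s) ?sm //= !normrM mulrA.
rewrite ler_piMr ?mulr_ge0 // normr_prod.
by apply: prodr_ile1 => q _; rewrite normr_ge0 f1.
Qed.

(** * Test inequalities for two nearby odeco tensors *)

Definition mode_ip (R : realType) p (d : 'I_p -> nat) (n n' : nat)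
    (u : 'I_n -> forall q, 'rV[R]_(d q)) (u' : 'I_n' -> forall q, 'rV[R]_(d q))
    k l q := dotv (u k q) (u' l q).

(** Symmetric in the two decompositions, so that each estimate also holds with their roles
    exchanged. *)
Definition odeco_near (R : realType) p (d : 'I_p -> nat) (n : nat)
    (lam lam' : 'I_n -> R) (u u' : 'I_n -> forall q, 'rV[R]_(d q)) (eps : R) :=
  [/\ (forall k, 0 <= lam k) /\ (forall k, 0 <= lam' k),
      forall q, orthonormal_family (fun k => u k q),
      forall q, orthonormal_family (fun k => u' k q) &
      forall x : forall q, 'rV[R]_(d q), (forall q, norm2 (x q) = 1) ->
        `|\sum_k lam k * \prod_q dotv (u k q) (x q)
          - \sum_k lam' k * \prod_q dotv (u' k q) (x q)| <= eps].

Lemma odeco_near_sym (R : realType) p (d : 'I_p -> nat) n (lam lam' : 'I_n -> R)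
    (u u' : 'I_n -> forall q, 'rV[R]_(d q)) eps :
  odeco_near lam lam' u u' eps -> odeco_near lam' lam u' u eps.
Proof. by case=> -[? ?] ? ? near; split => // x /near; rewrite distrC. Qed.

Lemma odeco_near_ge0 (R : realType) p (d : 'I_p -> nat) n (lam lam' : 'I_n -> R)
    (u u' : 'I_n -> forall q, 'rV[R]_(d q)) eps (k : 'I_n) :
  odeco_near lam lam' u u' eps -> 0 <= eps.
Proof.
case=> _ ou _ near; apply: le_trans (near (u k) _) => // q.
exact: orthonormal_norm2 (ou q).
Qed.

(* Testing both tensors on (u k) with its mode-m component replaced by y. *)
Lemma one_mode_test (R : realType) p (d : 'I_p -> nat) n (lam lam' : 'I_n -> R)
    (u u' : 'I_n -> forall q, 'rV[R]_(d q)) eps k m (y : 'rV[R]_(d m)) :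
  (3 <= p)%N -> odeco_near lam lam' u u' eps -> norm2 y = 1 ->
  `|lam k * dotv (u k m) y
    - \sum_l lam' l * (dotv (u' l m) y * \prod_(q < p | q != m) mode_ip u u' k l q)|
  <= eps.
Proof.
move=> p3 [_ ou _ near] y1.
have prod_dfwith (v : forall q, 'rV[R]_(d q)) :
    \prod_q dotv (v q) (dfwith (u k) m y q)
    = dotv (v m) y * \prod_(q < p | q != m) dotv (v q) (u k q).
  rewrite (bigD1 m) //= dfwithin; congr (_ * _).
  by apply: eq_bigr => q qm; rewrite dfwithout // eq_sym.
have unit_dfwith q : norm2 (dfwith (u k) m y q) = 1.
  by case: dfwithP => // r _; exact: orthonormal_norm2 (ou r).
have [r rm _] := exists_third m m p3.
move: (near _ unit_dfwith).
under eq_bigr do rewrite prod_dfwith.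
under [X in _ - X]eq_bigr do rewrite prod_dfwith.
(* Mode [r] still carries [u k r], so orthogonality kills every term [l != k] of the first sum. *)
rewrite (bigD1 k) //= [\sum_(_ | _ != _) _]big1 => [|l lk]; last first.
  by rewrite (bigD1 r) //= ou (negPf lk) mul0r !mulr0.
rewrite addr0 [\prod_(_ | _) dotv (u k _) _]big1 => [|q _]; last by rewrite ou eqxx.
rewrite mulr1; under [X in _ - X]eq_bigr do under eq_bigr do rewrite dotvC.
by [].
Qed.

Lemma mode_ip_le1 (R : realType) p (d : 'I_p -> nat) n (lam lam' : 'I_n -> R)
    (u u' : 'I_n -> forall q, 'rV[R]_(d q)) eps k l q :
  odeco_near lam lam' u u' eps -> `|mode_ip u u' k l q| <= 1.
Proof.
case=> _ ou ou' _.
exact: (orthonormal_dotv_le1 _ (ou q) (orthonormal_norm2 _ (ou' q))).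
Qed.

(** The test vector [y = u' l m] isolates the term [l] of the second sum; two of the remaining
    factors are kept. *)
Lemma entry_le (R : realType) p (d : 'I_p -> nat) n (lam lam' : 'I_n -> R)
    (u u' : 'I_n -> forall q, 'rV[R]_(d q)) eps k l m r s :
  (3 <= p)%N -> odeco_near lam lam' u u' eps ->
  r != m -> s != m -> s != r ->
  lam k * `|mode_ip u u' k l m|
  <= eps + lam' l * (`|mode_ip u u' k l r| * `|mode_ip u u' k l s|).
Proof.
move=> p3 near rm sm sr; have [[lam0 lam'0] _ ou' _] := near.
have := one_mode_test k p3 near (orthonormal_norm2 l (ou' m)).
rewrite (bigD1 l) //= [\sum_(_ | _ != _) _]big1 => [|j jl]; last first.
  by rewrite ou' (negPf jl) mul0r mulr0.
rewrite ou' eqxx mul1r addr0 => test.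
have [lamk lam'l] := (lam0 k, lam'0 l).
rewrite -[lam k]ger0_norm // -normrM -lerBlDr.
have := @normr_prod_le2 _ _ (mode_ip u u' k l) m r s
  (fun q => mode_ip_le1 k l q near) rm sm sr.
move=> /(ler_wpM2l lam'l); rewrite -{1}[lam' l]ger0_norm // -normrM => prod_le.
apply: le_trans (lerB (lexx _) prod_le) _.
exact: le_trans (lerB_dist _ _) test.
Qed.

(** * The dichotomy between close and far pairs *)

(** The threshold exceeds the square root of 1/2, which makes partners unique, and is below 1, which
    leaves a margin for far pairs. *)
Definition close (R : realType) p (d : 'I_p -> nat) n
    (u u' : 'I_n -> forall q, 'rV[R]_(d q)) k l :=
  [forall q, 3 / 4 < `|mode_ip u u' k l q|].

Lemma close_sym (R : realType) p (d : 'I_p -> nat) n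
    (u u' : 'I_n -> forall q, 'rV[R]_(d q)) k l :
  close u u' k l = close u' u l k.
Proof. by apply: eq_forallb => q; rewrite /mode_ip dotvC. Qed.

(* Bessel: two squared coefficients above 9/16 would add up to more than 1. *)
Lemma close_inj (R : realType) p (d : 'I_p -> nat) n
    (u u' : 'I_n -> forall q, 'rV[R]_(d q)) k k' l :
  (0 < p)%N -> (forall q, orthonormal_family (fun k => u k q)) ->
  (forall q, orthonormal_family (fun k => u' k q)) ->
  close u u' k l -> close u u' k' l -> k = k'.
Proof.
move=> p0 ou ou' /forallP/(_ (Ordinal p0)) + /forallP/(_ (Ordinal p0)).
set q := Ordinal p0; rewrite /mode_ip => akl ak'l.
apply/eqP/negPn/negP => kk'; have := bessel (u' l q) (ou q).
rewrite ou' eqxx (bigD1 k) //= (bigD1 k') 1?eq_sym //=.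
set rest := \sum_(_ | _) _; have : 0 <= rest by apply: sumr_ge0 => i _; exact: sqr_ge0.
rewrite -(real_normK (num_real (dotv (u k q) _))).
rewrite -(real_normK (num_real (dotv (u k' q) _))) => *; nra.
Qed.

Lemma exists_max_mode (R : realType) p (f : 'I_p -> R) :
  (0 < p)%N -> exists m, forall q, f q <= f m.
Proof.
move=> p0; have [m _ mmax] := arg_maxP f (erefl : predT (Ordinal p0)).
by exists m => q; exact: mmax.
Qed.

(* With m a mode maximizing |a_q|, the product over the other modes is at most
   3/4 |a_m|; adding the two inequalities of [entry_le] gives the claim. *)
Lemma not_close_far (R : realType) p (d : 'I_p -> nat) n (lam lam' : 'I_n -> R)
    (u u' : 'I_n -> forall q, 'rV[R]_(d q)) eps k l :
  (3 <= p)%N -> odeco_near lam lam' u u' eps -> ~~ close u u' k l ->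
  forall q, (lam k + lam' l) * `|mode_ip u u' k l q| <= 8 * eps.
Proof.
move=> p3 near nclose q0; have [[lam0 lam'0] _ _ _] := near.
have [lamk lam'l] := (lam0 k, lam'0 l).
have [m mmax] := exists_max_mode (fun q => `|mode_ip u u' k l q|) (ltnW (ltnW p3)).
(* If the small mode is the maximizing mode [m] itself, all modes are small and any other one will
   do. *)
have [r rm r34] : exists2 r, r != m & `|mode_ip u u' k l r| <= 3 / 4.
  move: nclose; rewrite negb_forall => /existsP[t]; rewrite -leNgt => t34.
  have [tm|] := eqVneq t m; last by exists t.
  have [r rm _] := exists_third m m p3; exists r => //.
  by apply: le_trans t34; rewrite tm.
have [s sm sr] := exists_third m r p3.
have h := entry_le k l p3 near rm sm sr.
have h' := entry_le l k p3 (odeco_near_sym near) rm sm sr.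
rewrite /mode_ip !(dotvC (u' l _)) in h'.
move: h h' (mmax s) (mmax q0) r34 (normr_ge0 (mode_ip u u' k l s)).
move: (normr_ge0 (mode_ip u u' k l r)); rewrite /mode_ip.
set am := `|_ (u k m) _|; set ar := `|_ (u k r) _|; set as_ := `|_ (u k s) _|.
set aq := `|_|.
move=> ar0 h h' sle qle r34 as0.
(* Hence [(lam k + lam' l) * am] is at most [2 * eps] plus 3/4 of itself, whence the 8. *)
have ars : ar * as_ <= 3 / 4 * am by apply: ler_pM.
have := ler_wpM2l lamk ars; have := ler_wpM2l lam'l ars.
have := ler_wpM2l (addr_ge0 lamk lam'l) qle.
lra.
Qed.

(** * Bounds for matched and unmatched components *)

(** At a maximizing mode [m] the product of two other entries is at most [am], so
    [(lam k - lam' l) * am <= eps] with [am > 3 / 4]. *)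
Lemma close_lambda_le (R : realType) p (d : 'I_p -> nat) n (lam lam' : 'I_n -> R)
    (u u' : 'I_n -> forall q, 'rV[R]_(d q)) eps k l :
  (3 <= p)%N -> odeco_near lam lam' u u' eps -> close u u' k l ->
  lam k - lam' l <= 9 * eps.
Proof.
move=> p3 near /forallP closekl; have [[lam0 lam'0] _ _ _] := near.
have [m mmax] := exists_max_mode (fun q => `|mode_ip u u' k l q|) (ltnW (ltnW p3)).
have [r rm _] := exists_third m m p3; have [s sm sr] := exists_third m r p3.
have := entry_le k l p3 near rm sm sr.
have : `|mode_ip u u' k l r| * `|mode_ip u u' k l s| <= `|mode_ip u u' k l m|.
  by rewrite -[leRHS]mul1r ler_pM // (mode_ip_le1 _ _ _ near).
move=> /(ler_wpM2l (lam'0 l)) h1 h2.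
have eps0 := odeco_near_ge0 k near.
have := closekl m; move: h1 h2; set am := `|mode_ip u u' k l m|; move=> h1 h2 am34.
have : (lam k - lam' l) * am <= eps by lra.
have [kl|/ltW kl] := lerP (lam k) (lam' l); first by lra.
have : (lam k - lam' l) * (3 / 4) <= (lam k - lam' l) * am.
  by rewrite ler_wpM2l ?subr_ge0 // ltW.
lra.
Qed.

(* The far terms of the sum in [one_mode_test] are controlled by
   Cauchy-Schwarz and Bessel in the modes r and m. *)
Lemma lambda_dotv_le (R : realType) p (d : 'I_p -> nat) n (lam lam' : 'I_n -> R)
    (u u' : 'I_n -> forall q, 'rV[R]_(d q)) eps k m (y : 'rV[R]_(d m)) :
  (3 <= p)%N -> odeco_near lam lam' u u' eps -> norm2 y = 1 ->
  (forall l, close u u' k l -> dotv (u' l m) y = 0) ->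
  lam k * dotv (u k m) y <= 9 * eps.
Proof.
move=> p3 near y1 orth; have [[lam0 lam'0] ou ou' _] := near.
have eps0 := odeco_near_ge0 k near.
have [r rm _] := exists_third m m p3; have [s sm sr] := exists_third m r p3.
have := le_trans (ler_norm _) (one_mode_test k p3 near y1).
rewrite lerBlDr => /le_trans; apply.
(* One [eps] comes from the test, eight from the far terms. *)
rewrite (_ : 9 * eps = eps + 8 * eps); last by ring.
rewrite lerD2l -[leRHS]mulr1.
(* By the inequality of arithmetic and geometric means, [b l] dominates the factors of modes [m] and
   [r]; by Bessel its sum is at most 1. Mode [s] is kept for the far bound. *)
pose b l := (dotv (u' l m) y ^+ 2 + mode_ip u u' k l r ^+ 2) / 2.
apply: (@le_trans _ _ (\sum_l 8 * eps * b l)); last first.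
  rewrite -mulr_sumr ler_wpM2l ?mulr_ge0 // -mulr_suml big_split /=.
  have h1 := bessel y (ou' m); have h2 := bessel (u k r) (ou' r).
  rewrite (norm2_eq1 y1) in h1; rewrite ou eqxx in h2.
  rewrite ler_pdivrMr // mul1r (_ : 2 = 1 + 1) // lerD //.
  by under eq_bigr do rewrite /mode_ip dotvC.
apply: ler_sum => l _; rewrite /b.
have [/orth ->|/(not_close_far p3 near)/(_ s) far] := boolP (close u u' k l).
  by rewrite mul0r mulr0 !mulr_ge0 // addr_ge0 // sqr_ge0.
apply: le_trans (ler_norm _) _; rewrite !normrM (ger0_norm (lam'0 l)).
have := @normr_prod_le2 _ _ (mode_ip u u' k l) m r s
  (fun q => mode_ip_le1 k l q near) rm sm sr.
move=> /(ler_wpM2l (mulr_ge0 (lam'0 l) (normr_ge0 (dotv (u' l m) y)))).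
rewrite -mulrA => /le_trans; apply.
rewrite -(real_normK (num_real (dotv _ y))) -(real_normK (num_real (mode_ip _ _ _ _ r))).
move: far (normr_ge0 (dotv (u' l m) y)) (normr_ge0 (mode_ip u u' k l r)).
move: (normr_ge0 (mode_ip u u' k l s)); set x := `|dotv _ y|.
set z := `|mode_ip _ _ _ _ r|; set w := `|mode_ip _ _ _ _ s| => w0 far x0 z0.
have far' : lam' l * w <= 8 * eps.
  by apply: le_trans far; rewrite ler_wpM2r // lerDr.
rewrite (_ : lam' l * x * (z * w) = lam' l * w * (x * z)); last by ring.
apply: ler_pM; rewrite ?mulr_ge0 //.
have := sqr_ge0 (x - z); lra.
Qed.

Lemma close_sin_le (R : realType) p (d : 'I_p -> nat) n (lam lam' : 'I_n -> R)
    (u u' : 'I_n -> forall q, 'rV[R]_(d q)) eps k l m :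
  (3 <= p)%N -> odeco_near lam lam' u u' eps -> close u u' k l ->
  lam k * Num.sqrt (1 - mode_ip u u' k l m ^+ 2) <= 9 * eps.
Proof.
move=> p3 near closekl; have [_ ou ou' _] := near.
have p0 := ltnW (ltnW p3).
set sn := Num.sqrt _; set c := mode_ip u u' k l m.
(* A zero sine is treated apart, since [w] is normalized below by [sn^-1]. *)
have [->|sn0] := eqVneq sn 0.
  by rewrite mulr0 mulr_ge0 // (odeco_near_ge0 k near).
pose w := u k m - c *: u' l m.
have sn2 : sn ^+ 2 = 1 - c ^+ 2.
  rewrite sqr_sqrtr // subr_ge0 -real_normK ?num_real // expr_le1 //.
  exact: mode_ip_le1 near.
have uw : dotv (u k m) w = sn ^+ 2.
  by rewrite dotvBr dotvZr ou eqxx -/(mode_ip u u' k l m) -/c sn2 expr2.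
have u'w : dotv (u' l m) w = 0.
  by rewrite dotvBr dotvZr ou' eqxx dotvC -/(mode_ip u u' k l m) -/c mulr1 subrr.
have ww : dotv w w = sn ^+ 2 by rewrite {1}/w dotvBl dotvZl uw u'w mulr0 subr0.
have y1 : norm2 (sn^-1 *: w) = 1.
  by rewrite /norm2 dotvZl dotvZr ww expr2 mulKf // mulVf // sqrtr1.
have uy : dotv (u k m) (sn^-1 *: w) = sn by rewrite dotvZr uw expr2 mulKf.
rewrite -[X in _ * X]uy; apply: lambda_dotv_le near y1 _ => // l' closekl'.
rewrite dotvZr.
(* Partners are unique, so orthogonality to [u' l m] suffices. *)
suff -> : l' = l by rewrite u'w mulr0.
by move: closekl closekl'; rewrite !(close_sym u) => cl cl'; apply: close_inj cl' cl.
Qed.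

Lemma unmatched_lambda_le (R : realType) p (d : 'I_p -> nat) n (lam lam' : 'I_n -> R)
    (u u' : 'I_n -> forall q, 'rV[R]_(d q)) eps k :
  (3 <= p)%N -> odeco_near lam lam' u u' eps -> (forall l, ~~ close u u' k l) ->
  lam k <= 9 * eps.
Proof.
move=> p3 near nclose; have [_ ou _ _] := near.
have p0 := ltnW (ltnW p3).
have <- : lam k * dotv (u k (Ordinal p0)) (u k (Ordinal p0)) = lam k.
  by rewrite ou eqxx mulr1.
apply: lambda_dotv_le near (orthonormal_norm2 k (ou _)) _ => // l closekl.
by have := nclose l; rewrite closekl.
Qed.

(** * Construction of the permutation and conclusion *)

Lemma odeco_near_matching (R : realType) p (d : 'I_p -> nat) n
    (lam lam' : 'I_n -> R) (u u' : 'I_n -> forall q, 'rV[R]_(d q)) eps :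
  (3 <= p)%N -> odeco_near lam lam' u u' eps ->
  exists pi : {perm 'I_n}, forall k, `|lam k - lam' (pi k)| <= 9 * eps
    /\ forall q, lam k * sin (angle (u k q) (u' (pi k) q)) <= 9 * eps.
Proof.
move=> p3 near; have near' := odeco_near_sym near.
have [[lam0 lam'0] ou ou' _] := near; have p0 := ltnW (ltnW p3).
have closeE x y z : close u u' x y -> close u u' x z -> y = z.
  by rewrite !(close_sym u); exact: close_inj.
have closeI x y z : close u u' x z -> close u u' y z -> x = y by exact: close_inj.
have [pi piP] := perm_of_matching closeE closeI.
exists pi => k.
have sinE q : sin (angle (u k q) (u' (pi k) q))
              = Num.sqrt (1 - mode_ip u u' k (pi k) q ^+ 2).
  rewrite sin_angle ?(orthonormal_norm2 _ (ou q)) ?(orthonormal_norm2 _ (ou' q)) //.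
  exact: mode_ip_le1 near.
have [closek|nclosek] := boolP (close u u' k (pi k)).
  split=> [|q]; last by rewrite sinE; exact: close_sin_le near closek.
  rewrite ler_norml (close_lambda_le p3 near closek) andbT lerNl opprB.
  by apply: (close_lambda_le p3 near'); rewrite -close_sym.
(* As [pi] respects every close pair, neither [k] nor [pi k] has a close partner; both coefficients
   then lie between 0 and [9 * eps]. *)
have lamk : lam k <= 9 * eps.
  apply: unmatched_lambda_le near _ => // l; apply/negP => ckl.
  by move: nclosek; rewrite (piP _ _ ckl) ckl.
have lam'k : lam' (pi k) <= 9 * eps.
  apply: unmatched_lambda_le near' _ => // l; rewrite -close_sym; apply/negP => clk.
  by move: nclosek; rewrite -(perm_inj (piP _ _ clk)) (piP _ _ clk) clk.
split=> [|q]; first by have := lam0 k; have := lam'0 (pi k); rewrite ler_norml; lra.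
apply: le_trans lamk; rewrite sinE ler_piMr // -[leRHS]sqrtr1 ler_wsqrtr //.
by rewrite gerBl sqr_ge0.
Qed.

Theorem corollary3p3 (R : realType) :
  exists2 C : R, 1 <= C &
  forall (p : nat) (d : 'I_p -> nat),
    (3 <= p)%N ->
    (forall q : 'I_p, (1 <= d q)%N) ->
  forall (lambda lambda' : 'I_(dmin d) -> R)
         (u u' : 'I_(dmin d) -> forall q : 'I_p, 'rV[R]_(d q))
         (T E X T' : tensor R d),
    odeco_decomposition lambda u T ->
    X = T + E ->
    odeco_decomposition lambda' u' T' ->
  exists pi : {perm 'I_(dmin d)}, forall k : 'I_(dmin d),
    `|lambda k - lambda' (pi k)|
      <= C * (spectral_norm (T' - X) + spectral_norm E)
    /\
    (* the bound is void when lambda k = 0, where 1 / 0 stands for +oo *)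
    (lambda k != 0 ->
     \big[Num.max/0]_(q < p) sin (angle (u k q) (u' (pi k) q))
       <= C * (spectral_norm (T' - X) + spectral_norm E) / lambda k).
Proof.
exists 9 => [|p d p3 _ lam lam' u u' T E X T' [_ lam0 ou TE] XE [_ lam'0 ou' T'E]].
  by rewrite ler1n.
set eps := _ + _.
have near : odeco_near lam lam' u u' eps.
  split=> // x x1; rewrite -!dott_sumZ_outer -TE -T'E distrC.
  have -> : dott T' (outer x)
            = dott (T' - X) (outer x) + dott E (outer x) + dott T (outer x).
    by rewrite -!dottDl XE -addrA [E + T]addrC subrK.
  have p0 := ltnW (ltnW p3).
  by rewrite addrK (le_trans (ler_normD _ _)) // lerD // normr_dott_le.
have [pi piP] := odeco_near_matching p3 near.
exists pi => k; have [lamk sink] := piP k; split=> // lamk0.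
have lamk_gt0 : 0 < lam k by rewrite lt_def lamk0 lam0.
(* The default value 0 of the maximum requires the bound to be nonnegative. *)
apply: bigmax_le => [|q _].
  by rewrite divr_ge0 // ?mulr_ge0 // (odeco_near_ge0 k near).
by rewrite ler_pdivlMr // mulrC.
Qed.
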